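(* Let $n\ge 2$ and let $\pi\in M_{2n}$ have a difference sequence that is periodic with period $p$. Then the number of valid pointer contexts (of the permutation in $S_{2n}$ whose contraction is $\pi$) is a multiple of $\frac{2n-1}{p}$.
   Context: Permutations are bijections of $\mathbb Z_N$ written $[\pi(1)\ \cdots\ \pi(N)]$; indices and entries are taken modulo $N$. For $\pi\in S_N$ the difference sequence $D_\pi$ is $D_\pi(k)=\pi(k+1)-\pi(k)$ for $1\le k<N$ and $D_\pi(N)=\pi(1)-\pi(N)$; it is periodic with period $p$ if $p$ is the smallest integer with $0<p<N$ such that $D_\pi(k+p)=D_\pi(k)$ for all $k$. Pointers: entry $k$ has left pointer $(k-1,k)$ and right pointer $(k,k+1)$; the pointer word $W(\pi)$ lists $L(\pi(1))R(\pi(1))\cdots L(\pi(N))R(\pi(N))$ with $(0,1)$ and $(N,N+1)$ removed. Two distinct pointers form a valid pointer context if their occurrences in $W(\pi)$ interleave ($p\ldots q\ldots p\ldots q$ or $q\ldots p\ldots q\ldots p$). Strategic pile: with $X_N=(0\ 1\ \cdots\ N)$, $Y_\pi=(\pi(N)\ \cdots\ \pi(1)\ 0)$ and $C_\pi=Y_\pi\circ X_N$, $\mathrm{SP}(\pi)$ is the set of numbers after $N$ and before $0$ in the cycle of $C_\pi$ containing $0$ and $N$ (empty if different cycles). $\pi\in S_{2n}$ has maximal strategic pile if $|\mathrm{SP}(\pi)|=2n-1$; then $2n$ is immediately followed by $1$, and its contraction is the element of $S_{2n-1}$ obtained by deleting the entry $2n$, with the pointer $(2n-1,2n)$ renamed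 $(2n-1,1)$. $M_{2n}$ is the set of all such contractions. *)

(* Defs.v *)
From mathcomp Require Import all_boot perm.

Set Implicit Arguments.
Unset Strict Implicit.
Unset Printing Implicit Defensive.

(* A permutation [s(1) ... s(N)] of {1, ..., N} is encoded as s : 'S_N with
   positions and entries shifted down by one: position i.+1 holds the entry
   (s i).+1, which is the value of [lift ord0 (s i)] in {0, ..., N}. *)
Definition one_line (N : nat) (s : 'S_N) : seq 'I_N.+1 :=
  [seq lift ord0 (s i) | i <- enum 'I_N].

(* Differences are taken in Z/N, as residues in {0, ..., N-1}; they are
   unaffected by the shift. [ordS] is the cyclic successor on positions. *)
Definition diff_seq (N : nat) (s : 'S_N) (k : 'I_N) : nat :=
  (s (ordS k) + (N - s k)) %% N.

Definition diff_invariant (N : nat) (s : 'S_N) (p : nat) : Prop :=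
  forall k : 'I_N, diff_seq s (iter p (@ordS N) k) = diff_seq s k.

Definition diff_periodic (N : nat) (s : 'S_N) (p : nat) : Prop :=
  [/\ 0 < p < N, diff_invariant s p
    & forall q, 0 < q < N -> diff_invariant s q -> p <= q].

Definition left_pointer (k : nat) : nat * nat := (k.-1, k).
Definition right_pointer (k : nat) : nat * nat := (k, k.+1).

Definition pointer_word (N : nat) (s : 'S_N) : seq (nat * nat) :=
  [seq x <- flatten [seq [:: left_pointer k; right_pointer k]
                    | k : 'I_N.+1 <- one_line s]
  | (x != (0, 1)) && (x != (N, N.+1))].

Definition interleaved (T : eqType) (w : seq T) (x y : T) : bool :=
  subseq [:: x; y; x; y] w || subseq [:: y; x; y; x] w.

(* Contexts are unordered pairs of distinct pointers occurring in the word. *)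
Definition valid_contexts (N : nat) (s : 'S_N) :
    {set {set seq_sub (pointer_word s)}} :=
  [set A : {set seq_sub (pointer_word s)} |
    [exists x, exists y, [&& A == [set x; y], x != y
      & interleaved (pointer_word s) (val x) (val y)]]].

(* For a duplicate-free sequence c, [next c] is the cyclic permutation c. *)
Definition X_cycle (N : nat) : 'I_N.+1 -> 'I_N.+1 := next (enum 'I_N.+1).

Definition Y_cycle (N : nat) (s : 'S_N) : 'I_N.+1 -> 'I_N.+1 :=
  next (rcons (rev (one_line s)) ord0).

Definition C_perm (N : nat) (s : 'S_N) : 'I_N.+1 -> 'I_N.+1 :=
  Y_cycle s \o @X_cycle N.

(* [orbit (C_perm s) ord_max] lists the cycle of N, starting from N. *)
Definition strategic_pile (N : nat) (s : 'S_N) : {set 'I_N.+1} :=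
  let c := fingraph.orbit (C_perm s) ord_max in
  if ord0 \in c then [set x in behead (take (index ord0 c) c)] else set0.

Definition max_strategic_pile (n : nat) (s : 'S_(2 * n)) : bool :=
  #|strategic_pile s| == (2 * n).-1.

Definition is_contraction (n : nat) (s : 'S_(2 * n)) (t : 'S_(2 * n).-1) :
    bool :=
  max_strategic_pile s &&
  ([seq val x | x <- one_line t] ==
   [seq val x | x <- one_line s & val x != 2 * n]).

Definition contractions (n : nat) : {set 'S_(2 * n).-1} :=
  [set t | [exists s : 'S_(2 * n), is_contraction s t]].

(* Main.v *)
(* In sigma the entry 2n is immediately followed by 1, because the cycle of
   C_sigma reads 2n, the pile, 0. Hence the pointer word of sigma is the word
   obtained from the contraction pi by replacing each entry k with the letters
   k-1, k of Z/(2n-1). Interleaving of two letters does not depend on where a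
   cyclic word is cut. If D_pi has period p then p divides 2n-1 and
   pi(k+p) = pi(k) + c for some c of additive order m = (2n-1)/p, so cutting the
   word p entries later amounts to translating its letters by c. Thus c acts on
   the valid contexts; as 2n-1 is odd, no nonzero translation fixes an unordered
   pair, all orbits have m elements, and m divides the number of contexts. *)
Require Import Defs.
From mathcomp Require Import all_boot perm ssralg zmodp.

Set Implicit Arguments.
Unset Strict Implicit.
Unset Printing Implicit Defensive.

Import GRing.Theory.

(** * Interleaving under relabelling and rotation of words *)

Lemma subseq_map_inj (T1 T2 : eqType) (f : T1 -> T2) (s1 s2 : seq T1) :
  injective f -> subseq (map f s1) (map f s2) = subseq s1 s2.
Proof.
move=> f_inj; apply/idP/idP=> [|/(map_subseq f)//].
case/subseqP=> m; rewrite size_map => size_m.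
rewrite -map_mask => /(inj_map f_inj) ->; exact: mask_subseq.
Qed.

Lemma interleaved_map (T1 T2 : eqType) (f : T1 -> T2) (w : seq T1) x y :
  injective f -> interleaved (map f w) (f x) (f y) = interleaved w x y.
Proof.
move=> f_inj; rewrite /interleaved.
by rewrite -(subseq_map_inj [:: x; y; x; y] w f_inj)
           -(subseq_map_inj [:: y; x; y; x] w f_inj).
Qed.

Lemma interleavedC (T : eqType) (w : seq T) x y :
  interleaved w x y = interleaved w y x.
Proof. by rewrite /interleaved orbC. Qed.

(** If the pattern x y x y starts at [z], the rest y x y lies in [w] and the moved letter completes
    y x y x; otherwise the whole pattern lies in [w]. *)
Lemma interleaved_rot1 (T : eqType) (w : seq T) x y z :
  interleaved (z :: w) x y -> interleaved (rcons w z) x y.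
Proof.
wlog: x y / subseq [:: x; y; x; y] (z :: w) => [IH|+ _].
  case/orP=> sub; first by apply: IH => //; rewrite /interleaved sub.
  by rewrite interleavedC; apply: IH => //; rewrite /interleaved sub.
rewrite /=; case: eqP => [<-|_] sub; rewrite /interleaved.
  by apply/orP; right; rewrite -cats1 (cat_subseq sub (subseq_refl [:: x])).
by rewrite (subseq_trans sub) ?subseq_rcons.
Qed.

Lemma interleaved_catC (T : eqType) (w1 w2 : seq T) x y :
  interleaved (w1 ++ w2) x y = interleaved (w2 ++ w1) x y.
Proof.
suff imp u v : interleaved (u ++ v) x y -> interleaved (v ++ u) x y.
  by apply/idP/idP; apply: imp.
elim: u v => [|z u IH] v; first by rewrite cats0.
by move/interleaved_rot1; rewrite rcons_cat => /IH; rewrite cat_rcons.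
Qed.

(** * Rotated intervals and orbit lengths *)

Lemma rot1_iota n :
  rot 1 (iota 0 n.+1) = [seq k.+1 %% n.+1 | k <- iota 0 n.+1].
Proof.
have iota_last : iota 0 n.+1 = iota 0 n ++ [:: n] by rewrite -addn1 iotaD.
rewrite {2}iota_last map_cat -[iota 0 n.+1]/(0 :: iota 1 n) rot1_cons -cats1.
congr (_ ++ _); last by rewrite /= modnn.
rewrite (iotaDl 1 0); apply/eq_in_map=> k; rewrite mem_iota add0n => /= lt_k.
by rewrite modn_small.
Qed.

Lemma order_eqP (T : finType) (f : T -> T) (x : T) (m : nat) :
    injective f -> 0 < m -> (forall j, (iter j f x == x) = (m %| j)) ->
  order f x = m.
Proof.
move=> f_inj m_gt0 iterE; apply/eqP; rewrite eqn_leq; apply/andP; split.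
  rewrite leqNgt; apply/negP=> m_lt.
  have := findex_iter m_lt; have/eqP -> : iter m f x == x by rewrite iterE.
  by rewrite findex0 => m0; rewrite -m0 in m_gt0.
by apply: dvdn_leq; rewrite ?order_gt0 // -iterE iter_order.
Qed.

(** * Contexts over a finite alphabet *)

Definition contexts (T : finType) (w : seq T) : {set {set T}} :=
  [set A : {set T} | [exists x, exists y,
    [&& A == [set x; y], x != y & interleaved w x y]]].

Lemma contextsP (T : finType) (w : seq T) (A : {set T}) :
  reflect (exists x y, [/\ A = [set x; y], x != y & interleaved w x y])
          (A \in contexts w).
Proof.
rewrite inE; apply: (iffP existsP) => [[x /existsP[y /and3P[/eqP-> ? ?]]]|].
  by exists x, y.
by case=> x [y [-> xy wxy]]; exists x; apply/existsP; exists y; rewrite eqxx xy.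
Qed.

(** Every letter occurs in [w], so [f] is a bijection onto the occurring pointers. This replaces
    [seq_sub] by a type on which translations act. *)
Lemma card_valid_contexts (N : nat) (s : 'S_N) (T : finType)
    (f : T -> nat * nat) (w : seq T) :
    injective f -> (forall x, x \in w) -> pointer_word s = map f w ->
  #|valid_contexts s| = #|contexts w|.
Proof.
move=> f_inj w_full s_word.
have f_in x : f x \in pointer_word s by rewrite s_word map_f.
pose h x : seq_sub (pointer_word s) := SeqSub (f_in x).
have h_inj : injective h by move=> x y /(congr1 val)/f_inj.
have h_surj z : exists x, z = h x.
  have := ssvalP z; rewrite {2}s_word => /mapP[x _ zE].
  by exists x; apply: val_inj.
have intE x y : interleaved (pointer_word s) (val (h x)) (val (h y))
              = interleaved w x y.
  by rewrite -(interleaved_map w x y f_inj) -s_word.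
rewrite -(card_imset _ (imset_inj h_inj)); apply: eq_card => A.
apply/idP/imsetP=> [|[B /contextsP[x [y [-> xy wxy]]] ->]].
  rewrite inE => /existsP[a /existsP[b /and3P[/eqP-> + +]]].
  have [x ->] := h_surj a; have [y ->] := h_surj b.
  rewrite intE (inj_eq h_inj) => xy wxy.
  exists [set x; y]; last by rewrite imsetU1 imset_set1.
  by apply/contextsP; exists x, y.
rewrite inE imsetU1 imset_set1; apply/existsP; exists (h x).
by apply/existsP; exists (h y); rewrite eqxx (inj_eq h_inj) xy intE.
Qed.

(** * Translations of Z/(2n-1), where 2n-1 is [M.+2] *)

Section ShiftAction.

Local Open Scope ring_scope.

Variable (M : nat).
Implicit Types (c : 'I_M.+2) (A : {set 'I_M.+2}).

Definition shift_set c A : {set 'I_M.+2} := [set x + c | x : 'I_M.+2 in A].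

Lemma shift_set_inj c : injective (shift_set c).
Proof. exact: imset_inj (addIr c). Qed.

Lemma mem_shift_set c A x : (x + c \in shift_set c A) = (x \in A).
Proof. exact: (mem_imset _ _ (addIr c)). Qed.

Lemma shift_set0 A : shift_set 0 A = A.
Proof.
by rewrite /shift_set (eq_imset (g := id)) ?imset_id // => x; rewrite addr0.
Qed.

Lemma iter_shift_set c j A : iter j (shift_set c) A = shift_set (c *+ j) A.
Proof.
elim: j => [|j IH] /=; first by rewrite shift_set0.
rewrite IH /shift_set -imset_comp; apply: eq_imset => x /=.
by rewrite mulrSr addrA.
Qed.

(* A translation fixing an unordered pair has order 1 or 2. *)
Lemma shift_pair_id c (x y : 'I_M.+2) :
  odd M -> x != y -> (shift_set c [set x; y] == [set x; y]) = (c == 0).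
Proof.
move=> oddM xy; apply/eqP/eqP=> [fixed|->]; last exact: shift_set0.
have : x + c \in [set x; y] by rewrite -{1}fixed mem_shift_set set21.
have : y + c \in [set x; y] by rewrite -{1}fixed mem_shift_set set22.
rewrite !inE; case/orP=> [/eqP yc|]; last first.
  by rewrite -subr_eq0 addrC addKr => /eqP.
case/orP=> [|/eqP xc]; first by rewrite -subr_eq0 addrC addKr => /eqP.
have c2 : c *+ 2 = 0.
  by apply: (addrI x); rewrite mulr2n addrA xc yc addr0.
apply: val_inj; move/(congr1 val): c2; rewrite Zp_mulrn /= => /eqP.
(* [M.+2] is odd, hence coprime to 2, so it divides the smaller number [c]. *)
rewrite -/(dvdn _ _) Gauss_dvdl; last by rewrite coprimen2 /= negbK.
by rewrite /dvdn modn_small // => /eqP.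
Qed.

Lemma dvdn_card_contexts c m (w : seq 'I_M.+2) :
    odd M -> (0 < m)%N -> (forall j, (c *+ j == 0) = (m %| j)%N) ->
    (forall x y, interleaved w (x + c) (y + c) = interleaved w x y) ->
  (m %| #|contexts w|)%N.
Proof.
move=> oddM m_gt0 cj w_shift; have f_inj := @shift_set_inj c.
(* The cardinality is [m] times the number of orbits, once all orbits have length [m] and the
   contexts are stable. *)
rewrite -(@fcard_order_set _ _ f_inj m (mem (contexts w))) ?dvdn_mull //.
  apply/subsetP=> A /contextsP[x [y [-> xy _]]]; rewrite inE; apply/eqP.
  by apply: order_eqP => // j; rewrite iter_shift_set shift_pair_id.
apply: (intro_closed (fconnect_sym f_inj)) => A B /= /eqP <-.
case/contextsP=> x [y [-> xy wxy]]; apply/contextsP; exists (x + c), (y + c).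
by rewrite /shift_set imsetU1 imset_set1 (inj_eq (addIr c)) w_shift.
Qed.

(** * Periodic differences and the cyclic word *)

Implicit Types s : 'S_M.+2.

(* The pointer word of the contraction, pointer (k, k+1) being named by k in
   Z/(2n-1); the entry encoded by [s i] is [s i + 1], hence the two letters. *)
Definition cyclic_word s : seq 'I_M.+2 :=
  flatten [seq [:: s i; s i + 1] | i <- enum 'I_M.+2].

Lemma mem_cyclic_word s x : x \in cyclic_word s.
Proof.
apply/flattenP; exists [:: x; x + 1]; last by rewrite mem_head.
by apply/mapP; exists (s^-1%g x); rewrite ?mem_enum ?permKV.
Qed.

Lemma ordSE (i : 'I_M.+2) : ordS i = i + 1.
Proof. by apply: val_inj; rewrite /= addn1. Qed.

Lemma iter_ordS p (i : 'I_M.+2) : iter p (@ordS _) i = i + p%:R.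
Proof.
elim: p => [|p IH]; first by rewrite addr0.
by rewrite iterS IH ordSE -addrA natr1.
Qed.

Lemma diff_seqE s k : diff_seq s k = s (k + 1) - s k.
Proof. by rewrite /diff_seq ordSE /= modnDmr. Qed.

Lemma natr_eq0_dvdn k : (k%:R == 0 :> 'I_M.+2) = (M.+2 %| k)%N.
Proof. by rewrite Zp_nat -val_eqE. Qed.

Lemma rot_enum_ord p : (p <= M.+2)%N ->
  rot p (enum 'I_M.+2) = [seq i + p%:R | i <- enum 'I_M.+2].
Proof.
elim: p => [_|p IH lt_p].
  by rewrite rot0 -[LHS]map_id; apply: eq_map => i; rewrite addr0.
rewrite rotS ?size_enum_ord // IH 1?ltnW // -map_rot.
suff -> : rot 1 (enum 'I_M.+2) = [seq i + 1 | i <- enum 'I_M.+2].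
  by rewrite -map_comp; apply: eq_map => i /=; rewrite -addrA nat1r.
apply: (inj_map val_inj); rewrite map_rot val_enum_ord -map_comp.
rewrite (eq_map (g := (fun k => k.+1 %% M.+2)%N \o val)); last first.
  by move=> i /=; rewrite addn1.
by rewrite map_comp val_enum_ord rot1_iota.
Qed.

Lemma interleaved_cyclic_word s p c x y :
    (p <= M.+2)%N -> (forall i, s (i + p%:R) = s i + c) ->
  interleaved (cyclic_word s) (x + c) (y + c) = interleaved (cyclic_word s) x y.
Proof.
move=> le_p s_shift.
rewrite -[RHS](interleaved_map _ _ _ (addIr c)) /cyclic_word.
(* The cut falls between entries, so the two letters of an entry stay together. *)
rewrite -[in LHS](cat_take_drop p (enum _)) map_cat flatten_cat.
rewrite interleaved_catC -flatten_cat -map_cat -/(rot p _) rot_enum_ord //.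
rewrite map_flatten -!map_comp; congr (interleaved (flatten _) _ _).
by apply: eq_map => i /=; rewrite s_shift addrAC.
Qed.

(** From i to i+1 the increment s(i+p) - s(i) changes by D(i+p) - D(i) = 0, so it keeps its value at
    i = 0. *)
Lemma diff_invariant_shift s p :
  diff_invariant s p -> exists c, forall i, s (i + p%:R) = s i + c.
Proof.
move=> inv; exists (s p%:R - s 0) => i; rewrite -(natr_Zp i).
elim: (val i) => [|k IH]; first by rewrite add0r addrC subrK.
have := inv k%:R; rewrite iter_ordS !diff_seqE => /val_inj diff_k.
rewrite -natr1 addrAC -[LHS](subrK (s (k%:R + p%:R))) diff_k IH.
by rewrite addrA subrK.
Qed.

(** By Bezout the gcd of [p] and [M.+2] is a multiple of [p] modulo [M.+2], hence leaves the
    differences invariant; minimality makes it [p]. *)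
Lemma diff_periodic_dvdn s p : diff_periodic s p -> (p %| M.+2)%N.
Proof.
case=> /andP[p_gt0 p_lt] inv min_p.
suff inv_gcd : diff_invariant s (gcdn p M.+2).
  suff /eqP <- : gcdn p M.+2 == p by rewrite dvdn_gcdr.
  have le_gcd : (gcdn p M.+2 <= p)%N by rewrite dvdn_leq ?dvdn_gcdl.
  rewrite eqn_leq le_gcd min_p //.
  by rewrite gcdn_gt0 p_gt0 (leq_ltn_trans le_gcd).
have inv_mul a : diff_invariant s (a * p).
  elim: a => [|a IH] k //; rewrite mulSn addnC.
  by rewrite addnC iterD inv IH.
have [a b eq_ab _] := egcdnP M.+2 p_gt0.
move=> k; rewrite -[RHS](inv_mul a) eq_ab !iter_ordS natrD natrM.
have /eqP -> : M.+2%:R == 0 :> 'I_M.+2 by rewrite natr_eq0_dvdn.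
by rewrite mulr0 add0r.
Qed.

Lemma dvdn_card_contexts_periodic s p :
  odd M -> diff_periodic s p -> (M.+2 %/ p %| #|contexts (cyclic_word s)|)%N.
Proof.
move=> oddM per; have dvd_p := diff_periodic_dvdn per.
case: per => /andP[p_gt0 p_lt] /diff_invariant_shift[c s_shift] _.
have s_shiftn j i : s (i + (j * p)%:R) = s i + c *+ j.
  elim: j => [|j IH]; first by rewrite !addr0.
  by rewrite mulSn addnC natrD addrA s_shift IH mulrSr addrA.
apply: (@dvdn_card_contexts c) => // [|j|x y].
- by rewrite divn_gt0 // ltnW.
(* As [s] is injective, [c *+ j] vanishes exactly when [M.+2] divides [j * p]. *)
- rewrite -[LHS](inj_eq (addrI (s 0))) addr0 -s_shiftn (inj_eq perm_inj) add0r.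
  by rewrite natr_eq0_dvdn -{1}(divnK dvd_p) dvdn_pmul2r.
- by apply: interleaved_cyclic_word s_shift; apply: ltnW.
Qed.

End ShiftAction.

(** * Strategic piles and the entry following 2n *)

Lemma one_line_uniq N (s : 'S_N) : uniq (one_line s).
Proof.
rewrite map_inj_uniq ?enum_uniq // => i j /lift_inj; exact: perm_inj.
Qed.

Lemma mem_one_line N (s : 'S_N) x : (x \in one_line s) = (x != ord0).
Proof.
apply/mapP/idP=> [[i _ ->]|]; first by rewrite eq_sym neq_lift.
rewrite eq_sym => /unlift_some[i -> _]; exists (s^-1%g i).
  by rewrite mem_enum.
by rewrite permKV.
Qed.

Lemma cons_one_line_uniq N (s : 'S_N) : uniq (ord0 :: one_line s).
Proof. by rewrite /= mem_one_line eqxx one_line_uniq. Qed.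

(** Reversing a duplicate-free cycle turns [next] into [prev]; thus [C_perm s] sends k to the
    predecessor of k+1 in the cycle 0, s(1), ..., s(N). *)
Lemma Y_cycleE N (s : 'S_N) : Y_cycle s =1 prev (ord0 :: one_line s).
Proof.
by move=> x; rewrite /Y_cycle -rev_cons next_rev // cons_one_line_uniq.
Qed.

Lemma C_perm_inj N (s : 'S_N) : injective (C_perm s).
Proof.
apply: inj_comp; first apply: eq_inj (fsym (Y_cycleE s)).
  exact/can_inj/next_prev/cons_one_line_uniq.
exact/can_inj/prev_next/enum_uniq.
Qed.

Lemma C_perm0 N (s : 'S_N.+1) :
  C_perm s ord0 = prev (ord0 :: one_line s) (lift ord0 ord0).
Proof.
rewrite /C_perm /= Y_cycleE; congr prev.
by rewrite /X_cycle next_nth mem_enum /= !enum_ordSl.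
Qed.

(* The pile has N+2 - 2 elements, so N, the pile and 0 form one cycle. *)
Lemma C_perm0_max_pile N (s : 'S_N.+1) :
  0 < N -> #|strategic_pile s| = N -> C_perm s ord0 = ord_max.
Proof.
move=> N_gt0; rewrite /strategic_pile; set c := fingraph.orbit _ _.
case: ifP => [c0|_]; last by rewrite cards0 => N0; rewrite -N0 in N_gt0.
have uniq_c : uniq c := orbit_uniq _ _.
rewrite cardsE (card_uniqP _); last first.
  by rewrite -drop1 drop_uniq // take_uniq.
have lt_index : index ord0 c < size c by rewrite index_mem.
rewrite size_behead size_takel 1?ltnW // => index_pred.
(* Since [N] is positive, the predecessor in [index_pred] is not truncated. *)
have indexE : index ord0 c = N.+1.
  move: N_gt0; rewrite -[in X in X -> _]index_pred -[in RHS]index_pred.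
  by case: index.
have orderE : order (C_perm s) ord_max = N.+2.
  apply/eqP; rewrite eqn_leq (leq_trans (max_card _)) ?card_ord //.
  by move: lt_index; rewrite indexE size_orbit.
have := nth_index ord_max c0; rewrite indexE /c /fingraph.orbit orderE.
rewrite nth_traject // => <-; rewrite -iterS.
by have := iter_order (@C_perm_inj _ s) ord_max; rewrite orderE.
Qed.

Lemma one_line_split N (s : 'S_N.+1) : C_perm s ord0 = ord_max ->
  exists a b, one_line s = a ++ ord_max :: lift ord0 ord0 :: b.
Proof.
rewrite C_perm0 => prev1; have := cons_one_line_uniq s.
have next_max : next (ord0 :: one_line s) ord_max = lift ord0 ord0.
  by rewrite -prev1 next_prev // cons_one_line_uniq.
have max_in : ord_max \in one_line s by rewrite mem_one_line.
move: next_max; case/splitPr: max_in => a b next_max uniq_ab.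
exists a; move: next_max; rewrite next_nth inE mem_cat mem_head !orbT /=.
have a_max : ord_max \notin a.
  move: uniq_ab; rewrite /= cat_uniq /= negb_or.
  by case/and3P=> _ _ /andP[/andP[]].
rewrite index_cat (negPf a_max) /= eqxx addn0 nth_cat ltnNge leqnSn /=.
(* With [b] empty, [nth] would return its default [ord0], which is not 1. *)
rewrite subSnn /=; by case: b {uniq_ab} => [|x b] //= ->; exists b.
Qed.

(** * Pointer words of a permutation and its contraction *)

(* Here M.+3 is 2n; the letter 0 of Z/(2n-1) is the pointer (2n-1, 2n), which
   the contraction renames (2n-1, 1). *)
Definition pointer_of M (k : nat) : nat * nat :=
  if k == 0 then (M.+2, M.+3) else (k, k.+1).

Lemma pointer_of_inj M : injective (fun k : 'I_M.+2 => pointer_of M k).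
Proof.
move=> i j; rewrite /pointer_of => eq_ij; apply: val_inj.
have := ltn_ord i; have := ltn_ord j; move/(congr1 fst): eq_ij => /=.
case: eqP => [->|_]; case: eqP => [->|_] //=; first by move=> <-; rewrite ltnn.
by move=> -> _; rewrite ltnn.
Qed.

(** Entries other than 2n and 1 give the same letters on both sides. The block 2n, 1 keeps only
    (2n-1, 2n) and (1, 2), which are the letters 0 and 1 given by the entry 1 of [pi]. *)
Lemma pointer_word_contraction M (sigma : 'S_M.+3) (pi : 'S_M.+2) a b :
    one_line sigma = a ++ ord_max :: lift ord0 ord0 :: b ->
    [seq val x | x <- one_line pi]
      = [seq val x | x <- one_line sigma & val x != M.+3] ->
  pointer_word sigma = [seq pointer_of M (val k) | k <- cyclic_word pi].
Proof.
move=> sigma_split contr.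
pose g k := [seq x <- [:: left_pointer k; right_pointer k]
            | (x != (0, 1)) && (x != (M.+3, M.+4))].
pose h k := [:: pointer_of M k.-1; pointer_of M (k %% M.+2)].
have sigmaE : pointer_word sigma
            = flatten [seq g k | k <- [seq val x | x <- one_line sigma]].
  by rewrite /pointer_word filter_flatten -!map_comp.
have piE : [seq pointer_of M (val k) | k <- cyclic_word pi]
         = flatten [seq h k | k <- [seq val x | x <- one_line pi]].
  rewrite /cyclic_word map_flatten /one_line -!map_comp; congr flatten.
  by apply: eq_map => i /=; rewrite /h /= /bump /= add1n addn1.
have inner x : x \in a ++ b -> 1 < val x < M.+3.
  have := one_line_uniq sigma; rewrite sigma_split.
  rewrite (uniq_catCA a [:: _; _]) /= inE !negb_or.
  move=> /and3P[/andP[_ x_max] x_1 _] x_ab; have : x \in one_line sigma.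
    rewrite sigma_split mem_cat !inE; move: x_ab.
    by rewrite mem_cat => /orP[]->; rewrite ?orbT.
  rewrite mem_one_line => x_0.
  have {x_max} := memPn x_max _ x_ab; have {x_1} := memPn x_1 _ x_ab.
  move: x_0; rewrite -!val_eqE /= => x0 x1 xmax.
  have := ltn_ord x; move: x0 x1 xmax; case: (nat_of_ord x) => [|[|k]] //= _ _.
  by rewrite [k.+2 < M.+4]ltnS [k.+2 <= _]leq_eqVlt => /negPf->.
have gh x : x \in a ++ b -> g (val x) = h (val x).
  move/inner; rewrite /g /h /left_pointer /right_pointer /pointer_of.
  case: (val x) => [|[|k]] //=; rewrite !ltnS => le_k; rewrite !xpair_eqE /=.
  rewrite (@ltn_eqF k.+1 M.+3) ?(@ltn_eqF k.+2 M.+3) ?ltnS ?(leqW le_k) //=.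
  congr [:: _; _].
  (* The entry 2n-1 is the boundary case: its right pointer is the letter 0. *)
  by case: ltngtP le_k => // [lt_k|->] _; rewrite ?modnn ?modn_small.
have keep c : {subset c <= a ++ b} -> [seq x <- c | val x != M.+3] = c.
  move=> sub; apply/all_filterP/allP=> x /sub/inner/andP[_ lt_x].
  by rewrite neq_ltn lt_x.
have hg c : {subset c <= a ++ b} ->
    [seq g k | k <- [seq val x | x <- c]]
      = [seq h k | k <- [seq val x | x <- c]].
  by move=> sub; rewrite -!map_comp; apply/eq_in_map=> x /sub/gh.
have sub_a : {subset a <= a ++ b} by move=> x xa; rewrite mem_cat xa.
have sub_b : {subset b <= a ++ b} by move=> x xb; rewrite mem_cat xb orbT.
rewrite sigmaE piE contr sigma_split filter_cat /= eqxx /= !keep //.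
rewrite !map_cat /= !flatten_cat /= !hg //; congr (_ ++ _).
by rewrite /g /pointer_of modn_small //= !xpair_eqE /= !eqxx
           (@ltn_eqF M.+2 M.+3).
Qed.

Theorem theorem4p5 (n : nat) (hn : 2 <= n)
    (pi : 'S_(2 * n).-1) (hpi : pi \in contractions n)
    (p : nat) (hp : diff_periodic pi p)
    (sigma : 'S_(2 * n)) (hsigma : is_contraction sigma pi) :
  (2 * n).-1 %/ p %| #|valid_contexts sigma|.
Proof.
clear hpi; have := hsigma; rewrite /is_contraction /max_strategic_pile.
(* With 2n written as [M.+3], the bound 4 <= 2n excludes the small cases and evenness of 2n makes
   [M] odd. *)
have := leq_mul (leqnn 2) hn; have : ~~ odd (2 * n) by rewrite oddM.
clear hn hsigma; move: pi hp sigma; move: (2 * n) => [|[|[|M]]] //=.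
rewrite !negbK => pi per sigma odd_M _ /andP[/eqP pile /eqP contr].
have [|a [b sigma_split]] := one_line_split (C_perm0_max_pile _ pile) => //.
have word := pointer_word_contraction sigma_split contr.
rewrite (card_valid_contexts (@pointer_of_inj M) (mem_cyclic_word pi) word).
exact: dvdn_card_contexts_periodic.
Qed.
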